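(* Let $\mathbb{Q}$ be a quantale, $(P,\mathcal{L},\to,D)$ a $\mathbb{Q}$-LTS and $\mathbb{V}=(S,\mathcal{L},\to,\Downarrow)$ a metric $\mathbb{Q}$-LTS that is a quantale (with order $\le_{\mathbb V}$). Suppose $P$ is closed under the binary parallel composition operator $|:P\times P\to P$, and that $D(p_1|p_2,q_1|q_2)\le_{\mathbb Q}D(p_1,q_1)+_{\mathbb Q}D(p_2,q_2)$ for all $p_1,p_2,q_1,q_2\in P$. Let $p_1,p_2\in P$ and $s_1,s_2\in S$. If $s_1$ is $p_2$-compatible and $s_2$ is $p_1$-compatible, then $\widehat{|}(p_1,p_2,s_1,s_2)\le_{\mathbb V}s_1+_{\mathbb V}s_2$.
   Context: Quantale: a structure $\mathbb{Q}=(Q,\bigwedge,\bigvee,\bot,\top,+)$ such that $(Q,\bigwedge,\bigvee,\bot,\top)$ is a complete lattice, $(Q,+,\bot)$ is a commutative monoid, and $e+\bigwedge A=\bigwedge\{e+f\mid f\in A\}$ for every $e\in Q$, $A\subseteq Q$. Order: $e\le f$ iff $e=\bigwedge\{e,f\}$. Metric (really pseudometric) on a set $A$ with values in a quantale: a map $m:A\times A\to\mathbb{Q}$ with $m(a,a)=\bot$, $m(a,b)=m(b,a)$, $m(a,c)\le m(a,b)+m(b,c)$. $\mathbb{Q}$-LTS: $(P,\mathcal{L},\to,D)$ with $P$ a set of processes, $\mathcal{L}$ labels, $\to\subseteq P\times\mathcal{L}\times P$, and $D:P\times P\to\mathbb{Q}$ a metric. Metric $\mathbb{Q}$-LTS (MLTS):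 $\mathbb{V}=(S,\mathcal{L},\to,\Downarrow)$ with $\to\subseteq S\times\mathcal{L}\times S$, $\Downarrow:S\to\mathbb{Q}$, endowed with $\bot_{\mathbb V},\top_{\mathbb V}\in S$, $\bigwedge_{\mathbb V},\bigvee_{\mathbb V}:2^S\to S$, $+_{\mathbb V}:S\times S\to S$ such that for all $\ell,s,s',s_1,s_2$ and $S'\subseteq S$: (i) $\bot_{\mathbb V}\xrightarrow{\ell}s$ iff $s=\bot_{\mathbb V}$; $\Downarrow\bot_{\mathbb V}=\bot_{\mathbb Q}$; (ii) $\top_{\mathbb V}$ has no outgoing transitions; $\Downarrow\top_{\mathbb V}=\top_{\mathbb Q}$; (iii) $\bigwedge_{\mathbb V}S'\xrightarrow{\ell}s$ iff some $s'\in S'$ has $s'\xrightarrow{\ell}s$; $\Downarrow\bigwedge_{\mathbb V}S'=\bigwedge_{\mathbb Q}\{\Downarrow s\mid s\in S'\}$; (iv) $\bigvee_{\mathbb V}S'\xrightarrow{\ell}s$ iff there are $S''\subseteq S$ with $s=\bigvee_{\mathbb V}S''$ and a surjective $f:S'\to S''$ with $s'\xrightarrow{\ell}f(s')$ for all $s'\in S'$; $\Downarrow\bigvee_{\mathbb V}S'=\bigvee_{\mathbb Q}\{\Downarrow s\mid s\in S'\}$; (v) $s_1+_{\mathbb V}s_2\xrightarrow{\ell}s'$ iff $s'=s_1'+_{\mathbb V}s_2'$ for some $s_1\xrightarrow{\ell}s_1'$, $s_2\xrightarrow{\ell}s_2'$; $\Downarrow(s_1+_{\mathbb V}s_2)=\Downarrow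 s_1+_{\mathbb Q}\Downarrow s_2$. $\le_{\mathbb V}$ is the largest relation $\mathcal{R}\subseteq S\times S$ such that $s_1\,\mathcal{R}\,s_2$ implies $\Downarrow s_1\le_{\mathbb Q}\Downarrow s_2$ and, for all $\ell$, whenever $s_2\xrightarrow{\ell}s_2'$ there is $s_1'$ with $s_1\xrightarrow{\ell}s_1'$ and $s_1'\,\mathcal{R}\,s_2'$. It is always a preorder; the standing assumption is that $\le_{\mathbb V}$ is a partial order, so that $\mathbb{V}$ is a quantale with lattice order $\le_{\mathbb V}$. Contextual bisimulation map: $m:P\times P\to S$ such that for all $p,q$: (1) $D(p,q)\le_{\mathbb Q}\Downarrow m(p,q)$; (2) if $m(p,q)\xrightarrow{\ell}s'$ then (a) $p\xrightarrow{\ell}p'$ implies there is $q'$ with $q\xrightarrow{\ell}q'$ and $m(p',q')\le_{\mathbb V}s'$; (b) $q\xrightarrow{\ell}q'$ implies there is $p'$ with $p\xrightarrow{\ell}p'$ and $m(p',q')\le_{\mathbb V}s'$. Contextual bisimilarity map: $\delta(p,q)=\bigwedge_{\mathbb V}\{m(p,q)\mid m\text{ is a contextual bisimulation map}\}$. Parallel composition: the transitions of $p|q$ are exactly those derived by the rules: if $p\xrightarrow{\ell}p'$ then $p|q\xrightarrow{\ell}p'|q$; if $q\xrightarrow{\ell}q'$ then $p|q\xrightarrow{\ell}p|q'$; if $p\xrightarrow{\ell}p'$ and $q\xrightarrow{\ell}q'$ then $p|q\xrightarrow{\ell}p'|q'$. Compatibility relation: $\mathcal{R}\subseteq S\times P$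 such that whenever $s\,\mathcal{R}\,p$: (1) $s\xrightarrow{\ell}s'$ implies $s'\,\mathcal{R}\,p$; (2) $s\xrightarrow{\ell}s'$ and $p\xrightarrow{\ell}p'$ imply $s'\,\mathcal{R}\,p'$ and $s\le_{\mathbb V}s'$. $s$ is $p$-compatible iff $s\,\mathcal{R}\,p$ for some compatibility relation $\mathcal{R}$. For a binary operator $f:P^2\to P$, $\hat f:P^2\times S^2\to S$ is $\hat f(p_1,p_2,s_1,s_2)=\bigvee_{\mathbb V}\{\delta(f(p_1,p_2),f(p_1',p_2'))\mid \delta(p_1,p_1')\le_{\mathbb V}s_1,\ \delta(p_2,p_2')\le_{\mathbb V}s_2\}$. *)

(* Defs.v *)
From mathcomp Require Import all_boot.
From mathcomp Require Export boolp classical_sets.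

Set Implicit Arguments.
Unset Strict Implicit.
Unset Printing Implicit Defensive.

Local Open Scope classical_set_scope.

Definition meet_le (T : Type) (inf : set T -> T) (e f : T) : Prop :=
  e = inf [set e; f].

Record is_partial_order (T : Type) (le : T -> T -> Prop) : Prop := {
  po_refl : forall x, le x x;
  po_antisym : forall x y, le x y -> le y x -> x = y;
  po_trans : forall x y z, le x y -> le y z -> le x z
}.

Record is_complete_lattice (T : Type) (le : T -> T -> Prop)
    (inf sup : set T -> T) (bot top : T) : Prop := {
  cl_po : is_partial_order le;
  cl_inf_lb : forall A x, A x -> le (inf A) x;
  cl_inf_glb : forall A y, (forall x, A x -> le y x) -> le y (inf A);
  cl_sup_ub : forall A x, A x -> le x (sup A);
  cl_sup_lub : forall A y, (forall x, A x -> le x y) -> le (sup A) y;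
  cl_bot : forall x, le bot x;
  cl_top : forall x, le x top
}.

Record is_comm_monoid (T : Type) (add : T -> T -> T) (zero : T) : Prop := {
  cm_assoc : forall x y z, add x (add y z) = add (add x y) z;
  cm_comm : forall x y, add x y = add y x;
  cm_zero : forall x, add zero x = x
}.

Record is_quantale (T : Type) (inf sup : set T -> T) (bot top : T)
    (add : T -> T -> T) : Prop := {
  quantale_lattice : is_complete_lattice (meet_le inf) inf sup bot top;
  quantale_monoid : is_comm_monoid add bot;
  quantale_distr : forall e A, add e (inf A) = inf [set add e f | f in A]
}.

Record quantale : Type := Quantale {
  qcar :> Type;
  qinf : set qcar -> qcar;
  qsup : set qcar -> qcar;
  qbot : qcar;
  qtop : qcar;
  qadd : qcar -> qcar -> qcar;
  qaxioms : is_quantale qinf qsup qbot qtop qadd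
}.

Arguments qbot {_}.
Arguments qtop {_}.

Definition qle (Q : quantale) : Q -> Q -> Prop := meet_le (@qinf Q).

Record is_metric (Q : quantale) (A : Type) (m : A -> A -> Q) : Prop := {
  metric_refl : forall a, m a a = qbot;
  metric_sym : forall a b, m a b = m b a;
  metric_triangle : forall a b c, qle (m a c) (qadd (m a b) (m b c))
}.

Record qlts (Q : quantale) (L : Type) : Type := QLTS {
  proc :> Type;
  ptrans : proc -> L -> proc -> Prop;
  pdist : proc -> proc -> Q;
  pdist_metric : is_metric pdist
}.

Arguments pdist {Q L _}.

Record mlts (Q : quantale) (L : Type) : Type := MLTS {
  mcar :> Type;
  mtrans : mcar -> L -> mcar -> Prop;
  mval : mcar -> Q;
  mbot : mcar;
  mtop : mcar;
  minf : set mcar -> mcar;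
  msup : set mcar -> mcar;
  madd : mcar -> mcar -> mcar;
  mbot_trans : forall l s, mtrans mbot l s <-> s = mbot;
  mbot_val : mval mbot = qbot;
  mtop_trans : forall l s, ~ mtrans mtop l s;
  mtop_val : mval mtop = qtop;
  minf_trans : forall (A : set mcar) l s,
    mtrans (minf A) l s <-> exists2 s', A s' & mtrans s' l s;
  minf_val : forall A, mval (minf A) = qinf [set mval s | s in A];
  (* [f @` A = B] says that [f] restricts to a surjection from [A] onto [B];
     the values of [f] outside [A] are irrelevant. *)
  msup_trans : forall (A : set mcar) l s,
    mtrans (msup A) l s <->
    exists (B : set mcar) (f : mcar -> mcar),
      [/\ s = msup B, f @` A = B & forall s', A s' -> mtrans s' l (f s')];
  msup_val : forall A, mval (msup A) = qsup [set mval s | s in A];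
  madd_trans : forall s1 s2 l s,
    mtrans (madd s1 s2) l s <->
    exists s1' s2', [/\ s = madd s1' s2', mtrans s1 l s1' & mtrans s2 l s2'];
  madd_val : forall s1 s2, mval (madd s1 s2) = qadd (mval s1) (mval s2)
}.

Arguments mbot {Q L} _.
Arguments mtop {Q L} _.

Section Mlts.
Variables (Q : quantale) (L : Type) (V : mlts Q L).

Definition mle_closed (R : V -> V -> Prop) : Prop :=
  forall s1 s2, R s1 s2 ->
    qle (mval s1) (mval s2) /\
    forall l s2', mtrans s2 l s2' -> exists2 s1', mtrans s1 l s1' & R s1' s2'.

(* The largest [mle_closed] relation, as the union of all of them. *)
Definition mle (s1 s2 : V) : Prop := exists2 R, mle_closed R & R s1 s2.

Definition mlts_quantale : Prop :=
  is_quantale (@minf Q L V) (@msup Q L V) (mbot V) (mtop V) (@madd Q L V) /\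
  forall s1 s2 : V, mle s1 s2 <-> meet_le (@minf Q L V) s1 s2.

End Mlts.

Section Bisimilarity.
Variables (Q : quantale) (L : Type) (P : qlts Q L) (V : mlts Q L).

Definition ctx_bisim_map (m : P -> P -> V) : Prop :=
  forall p q,
    qle (pdist p q) (mval (m p q)) /\
    forall l s', mtrans (m p q) l s' ->
      (forall p', ptrans p l p' ->
         exists2 q', ptrans q l q' & mle (m p' q') s') /\
      (forall q', ptrans q l q' ->
         exists2 p', ptrans p l p' & mle (m p' q') s').

Definition ctx_bisimilarity (p q : P) : V :=
  minf [set m p q | m in ctx_bisim_map].

Definition compatibility (R : V -> P -> Prop) : Prop :=
  forall s p, R s p ->
    (forall l s', mtrans s l s' -> R s' p) /\
    (forall l s' p', mtrans s l s' -> ptrans p l p' -> R s' p' /\ mle s s').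

Definition compatible (s : V) (p : P) : Prop :=
  exists2 R, compatibility R & R s p.

Definition op_hat (f : P -> P -> P) (p1 p2 : P) (s1 s2 : V) : V :=
  msup [set ctx_bisimilarity (f p1 p2) (f p1' p2')
       | p1' in [set p1' | mle (ctx_bisimilarity p1 p1') s1]
       & p2' in [set p2' | mle (ctx_bisimilarity p2 p2') s2]].

End Bisimilarity.

Inductive par_step (Q : quantale) (L : Type) (P : qlts Q L)
    (par : P -> P -> P) (p q : P) (l : L) : P -> Prop :=
| par_step_l p' : ptrans p l p' -> par_step par p q l (par p' q)
| par_step_r q' : ptrans q l q' -> par_step par p q l (par p q')
| par_step_sync p' q' :
    ptrans p l p' -> ptrans q l q' -> par_step par p q l (par p' q').

Definition is_parallel (Q : quantale) (L : Type) (P : qlts Q L)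
    (par : P -> P -> P) : Prop :=
  forall p q l r, ptrans (par p q) l r <-> par_step par p q l r.

Lemma qle_po (Q : quantale) : is_partial_order (@qle Q).
Proof. exact: (cl_po (quantale_lattice (qaxioms Q))). Qed.

Section MltsQuantale.
Variables (Q : quantale) (L : Type) (V : mlts Q L).

Lemma mle_is_closed : mle_closed (@mle Q L V).
Proof.
move=> s1 s2 [R HR Rs]; have [Hv Ht] := HR _ _ Rs; split=> // l s2' /Ht.
by case=> s1' Hs1 HR1; exists s1' => //; exists R.
Qed.

Lemma mle_refl (s : V) : mle s s.
Proof.
exists eq => // s1 _ <-; split; first exact: (po_refl (qle_po Q)).
by move=> l s' Hs; exists s'.
Qed.

Lemma mle_trans (s1 s2 s3 : V) : mle s1 s2 -> mle s2 s3 -> mle s1 s3.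
Proof.
move=> H12 H23; exists (fun a c => exists2 b : V, mle a b & mle b c); last first.
  by exists s2.
move=> {H12 H23 s1 s2 s3} a c [b /mle_is_closed[v1 t1] /mle_is_closed[v2 t2]].
split; first exact: (po_trans (qle_po Q)) v1 v2.
move=> l c' /t2[b' /t1[a' Ha ab] bc]; exists a' => //; by exists b'.
Qed.

(* To prove [mle s1 s2] it suffices to match one step up to [mle]. *)
Lemma mle_step (s1 s2 : V) :
  qle (mval s1) (mval s2) ->
  (forall l s2', mtrans s2 l s2' ->
     exists2 s1', mtrans s1 l s1' & mle s1' s2') ->
  mle s1 s2.
Proof.
move=> Hv Ht; exists (fun a b => mle a b \/ a = s1 /\ b = s2); last by right.
move=> a b [/mle_is_closed[va ta]|[-> ->]]; split=> // l b'.
- by move=> /ta[a' Ha Hab]; exists a' => //; left.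
- by move=> /Ht[a' Ha Hab]; exists a' => //; left.
Qed.

Lemma mle_inf_lb (A : set V) x : A x -> mle (minf A) x.
Proof.
have HQ := quantale_lattice (qaxioms Q).
move=> Ax; apply: mle_step; last first.
  by move=> l s Hs; exists s; [apply/minf_trans; exists x|exact: mle_refl].
by rewrite minf_val; apply: (cl_inf_lb HQ); exists x.
Qed.

Lemma mle_inf_glb (A : set V) y :
  (forall x, A x -> mle y x) -> mle y (minf A).
Proof.
have HQ := quantale_lattice (qaxioms Q).
move=> HA; apply: mle_step.
  rewrite minf_val; apply: (cl_inf_glb HQ) => _ [x Ax <-].
  by have [] := mle_is_closed (HA _ Ax).
move=> l s /minf_trans[x Ax xs].
by have [_ /(_ _ _ xs)] := mle_is_closed (HA _ Ax).
Qed.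

Lemma mle_sup_ub (A : set V) x : A x -> mle x (msup A).
Proof.
move=> Ax; exists (fun a b => exists2 B : set V, B a & b = msup B); last first.
  by exists A.
move=> {A Ax x} a _ [B Ba ->]; split.
  rewrite msup_val; apply: (cl_sup_ub (quantale_lattice (qaxioms Q))).
  by exists a.
move=> l s /msup_trans[C [f [-> <- Hf]]]; exists (f a); first exact: Hf.
by exists (f @` B) => //; exists a.
Qed.

Lemma mle_sup_lub (A : set V) y :
  (forall x, A x -> mle x y) -> mle (msup A) y.
Proof.
move=> HA.
exists (fun a b => exists2 B : set V, a = msup B & forall x, B x -> mle x b);
  last by exists A.
move=> {A HA y} _ b [B -> HB]; split.
  rewrite msup_val; apply: (cl_sup_lub (quantale_lattice (qaxioms Q))).
  by move=> _ [x Bx <-]; have [] := mle_is_closed (HB _ Bx).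
move=> l b' bb'.
have Hex x : exists x', B x -> mtrans x l x' /\ mle x' b'.
  have [Bx|nBx] := pselect (B x); last by exists x.
  have [_ /(_ _ _ bb')[x' xx' x'b']] := mle_is_closed (HB _ Bx).
  by exists x'.
have [f Hf] := choice Hex.
exists (msup (f @` B)).
  by apply/msup_trans; exists (f @` B), f; split=> // x /Hf[].
by exists (f @` B) => // _ [x /Hf[_ ?] <-].
Qed.

Lemma mle_bot (x : V) : mle (mbot V) x.
Proof.
exists (fun a _ => a = mbot V) => // _ s ->; split.
  by rewrite mbot_val; apply: (cl_bot (quantale_lattice (qaxioms Q))).
by move=> l s' _; exists (mbot V) => //; apply/mbot_trans.
Qed.

Lemma mle_top (x : V) : mle x (mtop V).
Proof.
apply: mle_step; last by move=> l s Hs; case: (mtop_trans Hs).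
by rewrite mtop_val; apply: (cl_top (quantale_lattice (qaxioms Q))).
Qed.

(* The quantale requirement on [V] is no stronger than asking the preorder
   [mle] to be a partial order. *)
Lemma mlts_quantaleP : mlts_quantale V <-> is_partial_order (@mle Q L V).
Proof.
split=> [[HV Hle]|Hpo].
  have Hpo := cl_po (quantale_lattice HV).
  split; [exact: mle_refl| |exact: mle_trans].
  by move=> x y /Hle xy /Hle yx; apply: (po_antisym Hpo).
have anti := po_antisym Hpo.
have Hle (s1 s2 : V) : mle s1 s2 <-> meet_le (@minf Q L V) s1 s2.
  split=> [H12|->]; last by apply: mle_inf_lb; right.
  apply: anti; last by apply: mle_inf_lb; left.
  by apply: mle_inf_glb => x [->|->] //; apply: mle_refl.
have eqle : meet_le (@minf Q L V) = @mle Q L V.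
  by apply: funext => x; apply: funext => y; apply/propext; split=> /Hle.
have [_ HM HD] := qaxioms Q.
have bisim (R : V -> V -> Prop) :
    (forall a b, R a b -> [/\ mval a = mval b,
       forall l a', mtrans a l a' -> exists2 b', mtrans b l b' & R a' b' &
       forall l b', mtrans b l b' -> exists2 a', mtrans a l a' & R a' b']) ->
    forall a b, R a b -> a = b.
  move=> HR a b Rab; apply: anti.
    exists R => // {Rab} {}a {}b /HR[vab _ tb]; split=> //.
    by rewrite vab; apply: (po_refl (qle_po Q)).
  exists (fun x y => R y x) => // {Rab} {}b {}a /HR[vab ta _]; split=> //.
  by rewrite vab; apply: (po_refl (qle_po Q)).
split=> //; split.
- rewrite eqle; split=> //; [exact: mle_inf_lb|exact: mle_inf_glb
    |exact: mle_sup_ub|exact: mle_sup_lub|exact: mle_bot|exact: mle_top].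
- split=> [x y z|x y|x].
  + pose R a b := exists x y z : V,
      a = madd x (madd y z) /\ b = madd (madd x y) z.
    apply: (bisim R); last by exists x, y, z.
    move=> {x y z} _ _ [x [y [z [-> ->]]]]; split.
    * by rewrite !madd_val (cm_assoc HM).
    * move=> l _ /madd_trans[x' [_ [-> xx' /madd_trans[y' [z' [-> yy' zz']]]]]].
      exists (madd (madd x' y') z'); last by exists x', y', z'.
      apply/madd_trans; exists (madd x' y'), z'; split=> //.
      by apply/madd_trans; exists x', y'.
    * move=> l _ /madd_trans[_ [z' [-> /madd_trans[x' [y' [-> xx' yy']]] zz']]].
      exists (madd x' (madd y' z')); last by exists x', y', z'.
      apply/madd_trans; exists x', (madd y' z'); split=> //.
      by apply/madd_trans; exists y', z'.
  + pose R a b := exists x y : V, a = madd x y /\ b = madd y x.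
    apply: (bisim R); last by exists x, y.
    move=> {x y} _ _ [x [y [-> ->]]]; split.
    * by rewrite !madd_val (cm_comm HM).
    * move=> l _ /madd_trans[x' [y' [-> xx' yy']]].
      exists (madd y' x'); last by exists x', y'.
      by apply/madd_trans; exists y', x'.
    * move=> l _ /madd_trans[y' [x' [-> yy' xx']]].
      exists (madd x' y'); last by exists x', y'.
      by apply/madd_trans; exists x', y'.
  + pose R a b := a = madd (mbot V) b.
    apply: (bisim R) => // {x} _ x ->; split.
    * by rewrite madd_val mbot_val (cm_zero HM).
    * move=> l _ /madd_trans[_ [x' [-> /mbot_trans-> xx']]].
      by exists x'.
    * move=> l x' xx'; exists (madd (mbot V) x') => //.
      apply/madd_trans; exists (mbot V), x'; split=> //.
      by apply/mbot_trans.
- move=> e A.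
  pose R a b := a = b \/ (a = madd e (minf A) /\ b = minf [set madd e f | f in A]).
  apply: (bisim R); last by right.
  move=> a _ [<-|[-> ->]].
    by split=> // l a' aa'; exists a' => //; left.
  split.
  + rewrite madd_val !minf_val HD; congr qinf; apply/seteqP; split=> x.
      move=> [_ [s As <-] <-]; exists (madd e s); last by rewrite madd_val.
      by exists s.
    move=> [_ [s As <-] <-]; rewrite madd_val; exists (mval s) => //.
    by exists s.
  + move=> l _ /madd_trans[e' [s' [-> ee' /minf_trans[s As ss']]]].
    exists (madd e' s'); last by left.
    apply/minf_trans; exists (madd e s); first by exists s.
    by apply/madd_trans; exists e', s'.
  + move=> l _ /minf_trans[_ [s As <-] /madd_trans[e' [s' [-> ee' ss']]]].
    exists (madd e' s'); last by left.
    apply/madd_trans; exists e', s'; split=> //.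
    by apply/minf_trans; exists s.
Qed.

End MltsQuantale.

(* Main.v *)
(** Call [s1 + s2] a bound for the pair [(p1|p2, q1|q2)] when
    [δ(p1,q1) <= s1], [δ(p2,q2) <= s2], [s1] is [p2]-compatible and [s2] is
    [p1]-compatible.  The map sending a pair of processes to the infimum of its
    bounds is a contextual bisimulation map, hence lies above [δ].
    When only one component of a composition moves, both summands of the bound
    still move; compatibility supplies [s <= s'] for the summand of the idle
    component, so that the derivative is again a bound. *)
From mathcomp Require Import all_boot.
Require Import Defs.

Set Implicit Arguments.
Unset Strict Implicit.
Unset Printing Implicit Defensive.

Local Open Scope classical_set_scope.

Lemma qle_trans (Q : quantale) (a b c : Q) : qle a b -> qle b c -> qle a c.
Proof. exact: (po_trans (qle_po Q)). Qed.

Lemma qle_add (Q : quantale) (a b c d : Q) :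
  qle a b -> qle c d -> qle (qadd a c) (qadd b d).
Proof.
have [lat mon distr] := qaxioms Q.
have mono (e x y : Q) : qle x y -> qle (qadd e x) (qadd e y).
  (* The hypothesis is the equation [x = qinf [set x; y]], so distributivity makes [qadd e x] an
     infimum over a set containing [qadd e y]. *)
  by move=> ->; rewrite distr; apply: (cl_inf_lb lat); exists y => //; right.
move=> ab cd; apply: qle_trans (mono b _ _ cd).
by rewrite ![qadd _ c](cm_comm mon); apply: mono.
Qed.

Section Bisimilarity.
Variables (Q : quantale) (L : Type) (P : qlts Q L) (V : mlts Q L).

Local Notation delta := (@ctx_bisimilarity Q L P V).

Lemma ctx_bisimilarity_le (m : P -> P -> V) (p q : P) :
  ctx_bisim_map m -> mle (delta p q) (m p q).
Proof. by move=> hm; apply: mle_inf_lb; exists m. Qed.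

(** Each transition of an infimum comes from a single member [m p q]; the answer given by [m] also
    serves [delta], which lies below [m] at the derivatives. *)
Lemma ctx_bisimilarity_bisim : ctx_bisim_map delta.
Proof.
move=> p q; split.
  rewrite minf_val; apply: (cl_inf_glb (quantale_lattice (qaxioms Q))).
  by move=> _ [_ [m hm <-] <-]; have [] := hm p q.
move=> l s' /minf_trans[_ [m hm <-] /(proj2 (hm p q))[fwd bwd]].
split=> [p' /fwd[q' qq' le_s']|q' /bwd[p' pp' le_s']]; [exists q'|exists p'] => //;
  by apply: mle_trans le_s'; apply: ctx_bisimilarity_le.
Qed.

Section BelowBisimilarity.
Variables (p q : P) (s : V).
Hypothesis le_s : mle (delta p q) s.

Lemma pdist_le_val : qle (pdist p q) (mval s).
Proof.
have [le_val _] := mle_is_closed le_s.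
by apply: qle_trans le_val; have [] := ctx_bisimilarity_bisim p q.
Qed.

(** A transition of [s] is pulled back along [delta p q <= s] to one of [delta p q], where the
    bisimulation clause applies. *)
Lemma bisim_fwd l s' p' : mtrans s l s' -> ptrans p l p' ->
  exists2 q', ptrans q l q' & mle (delta p' q') s'.
Proof.
move=> ss' pp'; have [_ /(_ _ _ ss')[u du us']] := mle_is_closed le_s.
have [_ /(_ _ _ du)[/(_ _ pp')[q' qq' le_u] _]] := ctx_bisimilarity_bisim p q.
by exists q' => //; apply: mle_trans us'.
Qed.

Lemma bisim_bwd l s' q' : mtrans s l s' -> ptrans q l q' ->
  exists2 p', ptrans p l p' & mle (delta p' q') s'.
Proof.
move=> ss' qq'; have [_ /(_ _ _ ss')[u du us']] := mle_is_closed le_s.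
have [_ /(_ _ _ du)[_ /(_ _ qq')[p' pp' le_u]]] := ctx_bisimilarity_bisim p q.
by exists p' => //; apply: mle_trans us'.
Qed.

End BelowBisimilarity.

Lemma compatible_idle (s s' : V) (p : P) l :
  compatible s p -> mtrans s l s' -> compatible s' p.
Proof. by case=> R hR /hR[stay _] /stay sR; exists R. Qed.

Lemma compatible_move (s s' : V) (p p' : P) l :
  compatible s p -> mtrans s l s' -> ptrans p l p' ->
  compatible s' p' /\ mle s s'.
Proof.
case=> R hR /hR[_ move_R] ss' pp'; have [sR le_ss'] := move_R _ _ _ ss' pp'.
by split=> //; exists R.
Qed.

Variables (par : P -> P -> P) (Hpar : is_parallel par).

(** An indexed family, since [par] need not be injective: one pair may be bounded through several
    decompositions. Pairs that are not compositions have no bound, and the infimum is then that of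
    the empty set. *)
Inductive par_bound : P -> P -> set V :=
| ParBound p1 p2 q1 q2 s1 s2 :
    mle (delta p1 q1) s1 -> mle (delta p2 q2) s2 ->
    compatible s1 p2 -> compatible s2 p1 ->
    par_bound (par p1 p2) (par q1 q2) (madd s1 s2).

(** Here [p2] idles: the first clause of compatibility keeps [s1'] compatible with [p2], the second
    makes [s2'] compatible with [p1'] and gives [s2 <= s2']. No move of [q1] is mentioned, so both
    simulation directions can use it. *)
Lemma par_bound_left p1 p2 p1' q1' q2 s1 s2 s1' s2' l :
  mle (delta p1' q1') s1' -> mle (delta p2 q2) s2 ->
  compatible s1 p2 -> compatible s2 p1 ->
  mtrans s1 l s1' -> mtrans s2 l s2' -> ptrans p1 l p1' ->
  par_bound (par p1' p2) (par q1' q2) (madd s1' s2').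
Proof.
move=> d1 d2 c1 c2 t1 t2 pp'; have [c2' le2] := compatible_move c2 t2 pp'.
by apply: ParBound c2' => //; [exact: mle_trans le2|exact: compatible_idle t1].
Qed.

Lemma par_bound_right p1 p2 p2' q1 q2' s1 s2 s1' s2' l :
  mle (delta p1 q1) s1 -> mle (delta p2' q2') s2' ->
  compatible s1 p2 -> compatible s2 p1 ->
  mtrans s1 l s1' -> mtrans s2 l s2' -> ptrans p2 l p2' ->
  par_bound (par p1 p2') (par q1 q2') (madd s1' s2').
Proof.
move=> d1 d2 c1 c2 t1 t2 pp'; have [c1' le1] := compatible_move c1 t1 pp'.
by apply: ParBound c1' _ => //; [exact: mle_trans le1|exact: compatible_idle t2].
Qed.

Lemma par_bound_sync p1 p2 p1' p2' q1' q2' s1 s2 s1' s2' l :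
  mle (delta p1' q1') s1' -> mle (delta p2' q2') s2' ->
  compatible s1 p2 -> compatible s2 p1 ->
  mtrans s1 l s1' -> mtrans s2 l s2' -> ptrans p1 l p1' -> ptrans p2 l p2' ->
  par_bound (par p1' p2') (par q1' q2') (madd s1' s2').
Proof.
move=> d1 d2 c1 c2 t1 t2 pp1 pp2.
have [c1' _] := compatible_move c1 t1 pp2.
have [c2' _] := compatible_move c2 t2 pp1.
exact: ParBound.
Qed.

Lemma par_bound_fwd r t s l s' r' :
  par_bound r t s -> mtrans s l s' -> ptrans r l r' ->
  exists2 t', ptrans t l t' & par_bound r' t' s'.
Proof.
case=> p1 p2 q1 q2 s1 s2 d1 d2 c1 c2 /madd_trans[s1' [s2' [-> t1 t2]]].
move=> /Hpar[p1' pp1|p2' pp2|p1' p2' pp1 pp2].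
- have [q1' qq1 d1'] := bisim_fwd d1 t1 pp1.
  exists (par q1' q2); first exact/Hpar/par_step_l.
  exact: par_bound_left d1' d2 c1 c2 t1 t2 pp1.
- have [q2' qq2 d2'] := bisim_fwd d2 t2 pp2.
  exists (par q1 q2'); first exact/Hpar/par_step_r.
  exact: par_bound_right d1 d2' c1 c2 t1 t2 pp2.
- have [q1' qq1 d1'] := bisim_fwd d1 t1 pp1.
  have [q2' qq2 d2'] := bisim_fwd d2 t2 pp2.
  exists (par q1' q2'); first exact/Hpar/par_step_sync.
  exact: par_bound_sync d1' d2' c1 c2 t1 t2 pp1 pp2.
Qed.

(** The rule is dictated by the move of [t], but compatibility concerns [p1] and [p2], so it is fed
    with the answering moves found by [bisim_bwd]. *)
Lemma par_bound_bwd r t s l s' t' :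
  par_bound r t s -> mtrans s l s' -> ptrans t l t' ->
  exists2 r', ptrans r l r' & par_bound r' t' s'.
Proof.
case=> p1 p2 q1 q2 s1 s2 d1 d2 c1 c2 /madd_trans[s1' [s2' [-> t1 t2]]].
move=> /Hpar[q1' qq1|q2' qq2|q1' q2' qq1 qq2].
- have [p1' pp1 d1'] := bisim_bwd d1 t1 qq1.
  exists (par p1' p2); first exact/Hpar/par_step_l.
  exact: par_bound_left d1' d2 c1 c2 t1 t2 pp1.
- have [p2' pp2 d2'] := bisim_bwd d2 t2 qq2.
  exists (par p1 p2'); first exact/Hpar/par_step_r.
  exact: par_bound_right d1 d2' c1 c2 t1 t2 pp2.
- have [p1' pp1 d1'] := bisim_bwd d1 t1 qq1.
  have [p2' pp2 d2'] := bisim_bwd d2 t2 qq2.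
  exists (par p1' p2'); first exact/Hpar/par_step_sync.
  exact: par_bound_sync d1' d2' c1 c2 t1 t2 pp1 pp2.
Qed.

Hypothesis Hdist : forall p1 p2 q1 q2 : P,
  qle (pdist (par p1 p2) (par q1 q2)) (qadd (pdist p1 q1) (pdist p2 q2)).

Lemma inf_par_bound_bisim : ctx_bisim_map (fun r t => minf (par_bound r t)).
Proof.
move=> r t; split.
  rewrite minf_val; apply: (cl_inf_glb (quantale_lattice (qaxioms Q))).
  move=> _ [_ [p1 p2 q1 q2 s1 s2 d1 d2 _ _] <-]; rewrite madd_val.
  by apply: (qle_trans (Hdist _ _ _ _)); apply: qle_add; exact: pdist_le_val.
(* The transition belongs to one bound [s]; its derivative bounds the new pair, hence lies above the
   infimum there. *)
move=> l s' /minf_trans[s bound_s ss']; split=> [r' rr'|t' tt'].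
  have [t' tt' bound_s'] := par_bound_fwd bound_s ss' rr'.
  by exists t' => //; apply: mle_inf_lb.
have [r' rr' bound_s'] := par_bound_bwd bound_s ss' tt'.
by exists r' => //; apply: mle_inf_lb.
Qed.

End Bisimilarity.

Theorem proposition5p6 (Q : quantale) (L : Type) (P : qlts Q L) (V : mlts Q L)
    (HV : mlts_quantale V)
    (par : P -> P -> P) (Hpar : is_parallel par)
    (Hdist : forall p1 p2 q1 q2 : P,
       qle (pdist (par p1 p2) (par q1 q2)) (qadd (pdist p1 q1) (pdist p2 q2)))
    (p1 p2 : P) (s1 s2 : V)
    (Hs1 : compatible s1 p2) (Hs2 : compatible s2 p1) :
  mle (op_hat par p1 p2 s1 s2) (madd s1 s2).
Proof.
apply: mle_sup_lub => _ [q1 d1 [q2 d2 <-]].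
(* It remains to see that [madd s1 s2] is itself one of the bounds of the pair. *)
apply: mle_trans (ctx_bisimilarity_le _ _ (inf_par_bound_bisim V Hpar Hdist)) _.
by apply: mle_inf_lb; apply: ParBound.
Qed.
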